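(* Consider a semidiscretization $$D_t\{\widetilde{\mathbf g}(\mathbf x,\mathbf U)\}=\widetilde{\mathbf h}\bigl(\mathbf x,t,P(\mathbf x)\widetilde{\mathbf g}(\mathbf x,\mathbf U)\bigr),\qquad \widetilde{\mathbf g}(\mathbf x,\mathbf U)=P(\mathbf x)^{-1}\mathbf U, \tag{S}$$ that has the semidiscrete conservation law $$D_m\{\widetilde F_2(\mathbf x,t,\mathbf U,\mathbf U_t)\}+D_t\{\widetilde G_2(\mathbf x,\mathbf U)\}=0 \tag{C}$$ with quadratic density $$\widetilde G_2(\mathbf x,\mathbf U)=\tfrac12\mathbf U^TS(\mathbf x)\mathbf U+\mathbf w(\mathbf x)^T\mathbf U,\qquad S(\mathbf x)=S(\mathbf x)^T\in\mathbb R^{Mq\times Mq},\quad \mathbf w(\mathbf x)\in\mathbb R^{Mq},$$ and with no assumption on the form of the flux $\widetilde F_2$. Then the solution of any symplectic Runge--Kutta method applied to (S) satisfies a discrete version of (C). Precisely: let $(a_{i,j})_{i,j=1}^s,(b_i)_{i=1}^s,(c_i)_{i=1}^s$ be the real coefficients of an $s$-stage Runge--Kutta method with $$b_ia_{i,j}+b_ja_{j,i}-b_ib_j=0\qquad\text{for all } i,j=1,\dots,s,$$ and suppose $\widetilde{\mathbf g}_n,\widetilde{\mathbf g}_{n+1},\mathbf k_1,\dots,\mathbf k_s$ satisfy $$\widetilde{\mathbf g}_{n+1}=\widetilde{\mathbf g}_n+\Delta t\sum_{i=1}^sb_i\widetilde{\mathbf h}_i,\qquad \mathbf k_i=\widetilde{\mathbf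 g}_n+\Delta t\sum_{j=1}^sa_{i,j}\widetilde{\mathbf h}_j,\qquad \widetilde{\mathbf h}_i=\widetilde{\mathbf h}(\mathbf x,t_n+c_i\Delta t,P(\mathbf x)\mathbf k_i),$$ and put $\mathbf u_n=P(\mathbf x)\widetilde{\mathbf g}_n$, $\mathbf u_{n+1}=P(\mathbf x)\widetilde{\mathbf g}_{n+1}$. Then, at every grid point, $$D_m\Bigl\{\sum_{i=1}^sb_i\,\widetilde F_2\bigl(\mathbf x,t_n+c_i\Delta t,P(\mathbf x)\mathbf k_i,P(\mathbf x)\widetilde{\mathbf h}_i\bigr)\Bigr\}+D_n\{\widetilde G_2(\mathbf x,\mathbf u_n)\}=0 .$$
   Context: Grid and stencil. Fix $\Delta x,\Delta t>0$, integers $A\le B$, $M=B-A+1$, $q\ge1$, and a uniform spatial grid with spacing $\Delta x$ whose points are indexed by $k\in\mathbb Z$ (position $a+k\Delta x$). Let $\mathcal V$ be the real linear space of grid functions $\mathbb Z\to\mathbb R^q$ under consideration, assumed invariant under index shifts (for example all, or all periodic, grid functions). For $\mathbf W\in\mathcal V$ the stencil vector at $k$ is the vector in $\mathbb R^{Mq}$ with entries $W^\alpha_{k+m}$, $m=A,\dots,B$, $\alpha=1,\dots,q$; the vector $\mathbf x$ of stencil nodes at $k$ has entries $a+(k+m)\Delta x$, $m=A,\dots,B$. A function of $\mathbf x$ and of one or more stencil vectors (such as $\widetilde G_2$ or $\widetilde F_2$) is evaluated at every grid point $k$ using the stencil quantities at $k$, and so defines a scalar grid function $\Phi[k]$. $D_m$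 is the spatial forward difference, $(D_m\Phi)[k]=(\Phi[k+1]-\Phi[k])/\Delta x$. $D_n$ is the forward difference in time: $D_n\{\widetilde G_2(\mathbf x,\mathbf u_n)\}=\frac{1}{\Delta t}\bigl(\widetilde G_2(\mathbf x,\mathbf u_{n+1})-\widetilde G_2(\mathbf x,\mathbf u_n)\bigr)$. $D_t$ is the derivative in time. Data. $P(\mathbf x):\mathcal V\to\mathcal V$ is a time-independent invertible linear operator; for each $t$, $\widetilde{\mathbf h}(\mathbf x,t,\cdot):\mathcal V\to\mathcal V$ is a given map. (S) arises as a spatial discretization of a PDE system $D_t\{\mathbf g(x,[\mathbf u]_x)\}=\mathbf h(x,t,[\mathbf u]_x)$, where $[\mathbf u]_x$ denotes $\mathbf u$ and finitely many of its $x$-derivatives, and $\mathbf g$ is linear homogeneous in $[\mathbf u]_x$; (C) arises as a discretization of a conservation law $D_xF_2+D_tG_2=0$ whose density $G_2(x,[\mathbf u]_x)$ is a polynomial of degree two in $[\mathbf u]_x$ with no terms depending on $x$ only. Meaning of ''(S) has the semidiscrete conservation law (C)'': (C) vanishes whenever (S) holds, i.e. after substituting $\mathbf U_t=P(\mathbf x)\widetilde{\mathbf h}(\mathbf x,t,\mathbf U)$, at every grid point, for all $t$ and all $\mathbf U\in\mathcal V$, $$D_m\bigl\{\widetilde F_2\bigl(\mathbf x,t,\mathbf U,P(\mathbf x)\widetilde{\mathbf h}(\mathbf x,t,\mathbf U)\bigr)\bigr\}=-\bigl(\mathbf U^TS(\mathbf x)+\mathbf w(\mathbf x)^T\bigr)P(\mathbf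 x)\widetilde{\mathbf h}(\mathbf x,t,\mathbf U),$$ where on the right $\mathbf U$ and $P(\mathbf x)\widetilde{\mathbf h}$ stand for their stencil vectors at the grid point. *)

(* Defs.v *)
From HB Require Import structures.
From mathcomp Require Import all_boot all_order all_algebra.
From mathcomp Require Import boolp classical_sets functions reals.

Set Implicit Arguments.
Unset Strict Implicit.
Unset Printing Implicit Defensive.

Import Order.TTheory GRing.Theory Num.Theory.
Local Open Scope ring_scope.

(* For A <= B this is B - A + 1; stencil row i : 'I_(stencil_size A B) stands
   for the offset m = A + i in {A, ..., B}. *)
Definition stencil_size (A B : int) : nat := absz (B - A + 1).

Definition stencil_nodes (R : realType) (x0 dx : R) (A B k : int) :
    'cV[R]_(stencil_size A B) :=
  \col_i (x0 + (k + (A + i%:Z))%:~R * dx).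

(* The pair (offset i, component j) is flattened to the single index
   mxvec_index i j. *)
Definition stencil (R : realType) (q : nat) (A B : int)
    (W : int -> 'cV[R]_q) (k : int) : 'cV[R]_(stencil_size A B * q) :=
  (mxvec (\matrix_(i < stencil_size A B, j < q) W (k + (A + i%:Z)) j 0))^T.

Definition Dm (R : realType) (dx : R) (Phi : int -> R) (k : int) : R :=
  (Phi (k + 1) - Phi k) / dx.

(* Phi and Phi' are the grid functions at two successive time levels. *)
Definition Dn (R : realType) (dt : R) (Phi Phi' : int -> R) (k : int) : R :=
  (Phi' k - Phi k) / dt.

Definition quadratic_density (R : realType) (M N : nat)
    (S : 'cV[R]_M -> 'M[R]_N) (w : 'cV[R]_M -> 'cV[R]_N)
    (x : 'cV[R]_M) (U : 'cV[R]_N) : R :=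
  2^-1 * (U^T *m S x *m U) 0 0 + ((w x)^T *m U) 0 0.

(* The law D_m F + D_t G = 0 on solutions of U_t = P (h t U), where G is
   quadratic_density S w: since S is symmetric, D_t G = (U^T S + w^T) U_t.
   V is the space of admissible grid functions. *)
Definition has_semidiscrete_claw (R : realType) (q : nat) (x0 dx : R)
    (A B : int) (inV : {pred int -> 'cV[R]_q})
    (V : subLmodType inV)
    (P : V -> V) (h : R -> V -> V)
    (F : 'cV[R]_(stencil_size A B) -> R ->
         'cV[R]_(stencil_size A B * q) -> 'cV[R]_(stencil_size A B * q) -> R)
    (S : 'cV[R]_(stencil_size A B) -> 'M[R]_(stencil_size A B * q))
    (w : 'cV[R]_(stencil_size A B) -> 'cV[R]_(stencil_size A B * q)) : Prop :=
  forall (t : R) (U : V) (k : int),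
    Dm dx (fun l => F (stencil_nodes x0 dx A B l) t
                      (stencil A B (val U) l)
                      (stencil A B (val (P (h t U))) l)) k
    = - ((((stencil A B (val U) k)^T *m S (stencil_nodes x0 dx A B k)
           + (w (stencil_nodes x0 dx A B k))^T)
          *m stencil A B (val (P (h t U))) k) 0 0).

Definition symplectic_rk (R : realType) (s : nat)
    (a : 'I_s -> 'I_s -> R) (b : 'I_s -> R) : Prop :=
  forall i j, b i * a i j + b j * a j i - b i * b j = 0.

(* Main.v *)
(* Composing [P] with the stencil map at a grid point is linear, so the stencil
   vectors of [P k_i] and [u_(n+1)] are again Runge-Kutta stages and update for
   the stencil vectors [y_i] of [P h_i]. The increment of the quadratic density
   is then the [b]-weighted sum of the right-hand sides of the semidiscrete law
   at the stages, since symplecticity cancels the terms [y_i^T S y_j]. *)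
Require Import Defs.
From HB Require Import structures.
From mathcomp Require Import all_boot all_order all_algebra.
From mathcomp Require Import boolp classical_sets functions reals.
From mathcomp Require Import ring.

Set Implicit Arguments.
Unset Strict Implicit.
Unset Printing Implicit Defensive.

Import Order.TTheory GRing.Theory Num.Theory.
Local Open Scope ring_scope.

Lemma stencil_is_linear (R : realType) (q : nat) (A B k : int) :
  linear (fun W : int -> 'cV[R]_q => stencil A B W k).
Proof.
move=> a W W'; rewrite /stencil -!linearP /=; congr ((mxvec _)^T).
by apply/matrixP => i j; rewrite !mxE.
Qed.

(** A 1 by 1 matrix has the same entry as its transpose, and transposition reverses the product. *)
Lemma symmetric_formC (R : realType) (N : nat) (S : 'M[R]_N) (u v : 'cV[R]_N) :
  S = S^T -> (u^T *m S *m v) 0 0 = (v^T *m S *m u) 0 0.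
Proof.
move=> S_sym; transitivity ((u^T *m S *m v)^T 0 0); first by rewrite [RHS]mxE.
by rewrite !trmx_mul trmxK -S_sym mulmxA.
Qed.

(* By the symmetry of [S], exchanging [i] and [j] does not change the form, so
   twice the left-hand side has coefficients [b i * a i j + b j * a j i]. *)
Lemma symplectic_quadratic_sum (R : realType) (N s : nat) (S : 'M[R]_N)
    (a : 'I_s -> 'I_s -> R) (b : 'I_s -> R) (y : 'I_s -> 'cV[R]_N) :
  S = S^T -> symplectic_rk a b ->
  2 * (\sum_i b i * \sum_j a i j * ((y j)^T *m S *m y i) 0 0)
  = ((\sum_i b i *: y i)^T *m S *m (\sum_i b i *: y i)) 0 0.
Proof.
move=> S_sym symp.
have -> : ((\sum_i b i *: y i)^T *m S *m (\sum_i b i *: y i)) 0 0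
    = \sum_i \sum_j b i * b j * ((y j)^T *m S *m y i) 0 0.
  rewrite mulmx_sumr summxE; apply: eq_bigr => i _.
  rewrite linear_sum /= !mulmx_suml summxE; apply: eq_bigr => j _.
  by rewrite -scalemxAr [(_ *: _)^T]linearZ /= -!scalemxAl scalerA [LHS]mxE.
under eq_bigr do rewrite mulr_sumr.
rewrite mulr_natl mulr2n [X in _ + X]exchange_big -big_split /=.
apply: eq_bigr => i _; rewrite -big_split /=; apply: eq_bigr => j _.
rewrite (symmetric_formC (y i) (y j) S_sym) !mulrA -mulrDl; congr (_ * _).
by apply/eqP; rewrite -subr_eq0 symp.
Qed.

(** With [d] the [b]-weighted sum of the [y i], both sides equal [dt * (u^T S d + w^T d)] plus a
    term of order [dt ^ 2]. These last terms agree by [symplectic_quadratic_sum]. *)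
Lemma symplectic_rk_quadratic_density (R : realType) (M N s : nat)
    (S : 'cV[R]_M -> 'M[R]_N) (w : 'cV[R]_M -> 'cV[R]_N) (x : 'cV[R]_M)
    (dt : R) (a : 'I_s -> 'I_s -> R) (b : 'I_s -> R)
    (u : 'cV[R]_N) (y : 'I_s -> 'cV[R]_N) :
  S x = (S x)^T -> symplectic_rk a b ->
  quadratic_density S w x (u + dt *: \sum_i b i *: y i)
    - quadratic_density S w x u
  = dt * \sum_i b i *
      ((((u + dt *: \sum_j a i j *: y j)^T *m S x + (w x)^T) *m y i) 0 0).
Proof.
move=> S_sym symp; have := symplectic_quadratic_sum y S_sym symp.
rewrite /quadratic_density; set d := \sum_i b i *: y i.
set Q := \sum_i _ => QE.
(* The part of each stage at [u] sums to a form in [d]; the stage increments contribute the double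
   sum [Q]. *)
have -> : \sum_i b i *
      ((((u + dt *: \sum_j a i j *: y j)^T *m S x + (w x)^T) *m y i) 0 0)
    = (u^T *m S x *m d) 0 0 + ((w x)^T *m d) 0 0 + dt * Q.
  rewrite !mulmx_sumr !summxE mulr_sumr -!big_split /=.
  apply: eq_bigr => i _; rewrite -!scalemxAr.
  have -> : \sum_j a i j * ((y j)^T *m S x *m y i) 0 0
      = ((\sum_j a i j *: y j)^T *m S x *m y i) 0 0.
    rewrite linear_sum /= !mulmx_suml summxE; apply: eq_bigr => j _.
    by rewrite linearZ /= -!scalemxAl [RHS]mxE.
  rewrite [(_ + _)^T]linearD /= [(_ *: _)^T]linearZ /= !mulmxDl -!scalemxAl.
  do ![rewrite [(_ + _ : 'M_1) 0 0]mxE | rewrite [(_ *: _ : 'M_1) 0 0]mxE].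
  by ring.
rewrite [(_ + _)^T]linearD /= [(_ *: _)^T]linearZ /= !mulmxDl !mulmxDr.
rewrite -!scalemxAl -!scalemxAr.
do ![rewrite [(_ + _ : 'M_1) 0 0]mxE | rewrite [(_ *: _ : 'M_1) 0 0]mxE].
(* The two cross terms coincide, which absorbs the factor 1/2, and the form at [d] is [2 * Q]. *)
by rewrite (symmetric_formC d u S_sym) -QE; field.
Qed.

Theorem theorem2 (R : realType) (x0 dx dt : R) (A B : int) (q : nat)
  (dx_gt0 : 0 < dx) (dt_gt0 : 0 < dt) (leAB : A <= B) (q_gt0 : (0 < q)%N)
  (inV : {pred int -> 'cV[R]_q})
  (V : subLmodType inV)
  (V_shift : forall (d : int) (W : int -> 'cV[R]_q),
     W \in inV -> (fun k : int => W (k + d)) \in inV)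
  (P : {linear V -> V}) (g : V -> V)
  (PK : cancel P g) (gK : cancel g P)
  (h : R -> V -> V)
  (F : 'cV[R]_(stencil_size A B) -> R ->
       'cV[R]_(stencil_size A B * q) -> 'cV[R]_(stencil_size A B * q) -> R)
  (S : 'cV[R]_(stencil_size A B) -> 'M[R]_(stencil_size A B * q))
  (w : 'cV[R]_(stencil_size A B) -> 'cV[R]_(stencil_size A B * q))
  (S_sym : forall k : int, S (stencil_nodes x0 dx A B k)
                           = (S (stencil_nodes x0 dx A B k))^T)
  (claw : has_semidiscrete_claw x0 dx P h F S w)
  (s : nat) (a : 'I_s -> 'I_s -> R) (b c : 'I_s -> R)
  (symp : symplectic_rk a b)
  (tn : R) (gn gn1 : V) (K H : 'I_s -> V)
  (step : gn1 = gn + dt *: (\sum_(i < s) b i *: H i))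
  (stages : forall i, K i = gn + dt *: (\sum_(j < s) a i j *: H j))
  (HE : forall i, H i = h (tn + c i * dt) (P (K i)))
  (un un1 : V) (unE : un = P gn) (un1E : un1 = P gn1) :
  forall k : int,
    Dm dx (fun l => \sum_(i < s) b i *
             F (stencil_nodes x0 dx A B l) (tn + c i * dt)
               (stencil A B (val (P (K i))) l)
               (stencil A B (val (P (H i))) l)) k
    + Dn dt
        (fun l => quadratic_density S w (stencil_nodes x0 dx A B l)
                    (stencil A B (val un) l))
        (fun l => quadratic_density S w (stencil_nodes x0 dx A B l)
                    (stencil A B (val un1) l)) k
    = 0.
Proof.
move=> k; pose stk (W : int -> 'cV[R]_q) := stencil A B W k.
pose stk_lin := GRing.isLinear.Build R _ _ _ stk (@stencil_is_linear R q A B k).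
pose st : {linear (int -> 'cV[R]_q) -> 'cV[R]_(stencil_size A B * q)} :=
  HB.pack stk stk_lin.
pose L : {linear V -> 'cV[R]_(stencil_size A B * q)} := st \o (val \o P).
have LE W : stencil A B (val (P W)) k = L W by [].
(* Used with [e = b] for the update and with [e = a i] for stage [i]. *)
have L_comb (e : 'I_s -> R) :
    L (gn + dt *: \sum_i e i *: H i) = L gn + dt *: \sum_i e i *: L (H i).
  rewrite linearD linearZ linear_sum; congr (_ + _ *: _).
  by apply: eq_bigr => i _; apply: linearZ.
rewrite /Dn unE un1E !LE step L_comb
  (symplectic_rk_quadratic_density _ _ _ _ (S_sym k) symp).
rewrite [_ * _ / dt]mulrAC mulfV ?gt_eqF // mul1r.
(* Flux difference and density increment are now both [b]-weighted sums over the stages, and they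
   cancel stage by stage. *)
rewrite /Dm -sumrB mulr_suml -big_split /= big1 // => i _.
rewrite -mulrBr -mulrA -mulrDr.
(* The semidiscrete law holds for every grid function in [V], not only along solutions in time, so
   it applies to the stage value [P (K i)]. *)
have := claw (tn + c i * dt) (P (K i)) k; rewrite -HE /Dm => ->.
by rewrite !LE {1}stages L_comb addNr mulr0.
Qed.
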